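(* Let $\mu>0$ and let $h$ be an intensity function with $\int_0^\infty h(y)\,dy=\infty$. Then $$\lim_{x_e\to \infty}PoA(h, x_e)=\lim_{x_e\to\infty}\frac{ \int_{0}^{x_e} h(y)\,dy}{\int_{0}^{x_e} \left(1-\frac{y}{x_e}\right)h(y)\,dy},$$ meaning that the first limit exists if and only if the second limit exists, and in that case they are equal.
   Context: Fix $\mu>0$ (service rate) and $c_t>0$ (travel cost per unit distance). An intensity function is a nonnegative measurable function $h$ on $[0,\infty)$ such that $\lambda(x)=\int_0^x h(y)\,dy$ is finite for all $x\ge 0$. In the M/G/1/1 loss system, customers with distance less than $x$ from the server arrive as a Poisson process of rate $\lambda(x)$; a customer joins only if the server is idle and his distance is at most the threshold in use. The service value is $R$, the waiting cost per unit time is $c_w$, and $x_e=\frac{R\mu-c_w}{c_t\mu}>0$ is the Nash equilibrium threshold (treated as a positive parameter, with $\mu$ and $h$ fixed). The expected social benefit per unit time with threshold $x\ge 0$ is $$S(x)=\frac{c_t\int_0^x (x_e-y)h(y)\,dy}{1+\frac1\mu\int_0^x h(y)\,dy}.$$ The socially optimal threshold $x^*$ (which maximizes $S$ over $x\ge0$) is the unique $x\ge 0$ satisfying $x_e=\frac1\mu\int_0^{x}(x-y)h(y)\,dy+x$; it depends on $x_e$, $h$ and $\mu$. The price of anarchy is $$PoA(h,x_e)=\frac{S(x^* )}{S(x_e)}=\frac{\int_{0}^{x^*} (x_e-y)h(y)\,dy}{\int_{0}^{x_e} (x_e-y)h(y)\,dy}\cdot\frac{1+\frac{1}{\mu} \int_{0}^{x_e}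 h(y)\,dy}{1+\frac{1}{\mu} \int_{0}^{x^*} h(y)\,dy}$$ (defined whenever $\int_0^{x_e}h(y)\,dy>0$; $c_t$ cancels). Limits are allowed to equal $+\infty$. *)

(* Defs.v *)
From HB Require Import structures.
From mathcomp Require Import all_boot all_order all_algebra.
From mathcomp Require Import all_classical all_reals all_analysis.
Set Implicit Arguments.
Unset Strict Implicit.
Unset Printing Implicit Defensive.
Import Order.TTheory GRing.Theory Num.Theory.
Import numFieldNormedType.Exports.
Local Open Scope classical_set_scope.
Local Open Scope ring_scope.

(* The values of h at negative arguments are irrelevant. *)
Definition intensity_function (R : realType) (h : R -> R) : Prop :=
  [/\ measurable_fun (`[0, +oo[ : set R) h,
      (forall y : R, 0 <= y -> 0 <= h y) &
      (forall x : R, 0 <= x ->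
         (\int[@lebesgue_measure R]_(y in `[0%R, x]) (h y)%:E < +oo)%E)].

Definition arrival_rate (R : realType) (h : R -> R) (x : R) : R :=
  \int[@lebesgue_measure R]_(y in `[0, x]) h y.

Definition social_benefit (R : realType) (ct mu : R) (h : R -> R) (xe x : R) : R :=
  ct * (\int[@lebesgue_measure R]_(y in `[0, x]) ((xe - y) * h y))
  / (1 + mu^-1 * arrival_rate h x).

(* The optimality condition for maximizing social_benefit over x >= 0; unlike a
   maximizer, its solution is unique even where h vanishes on an interval. *)
Definition optimality_equation (R : realType) (mu : R) (h : R -> R) (xe x : R) : Prop :=
  0 <= x /\
  xe = mu^-1 * (\int[@lebesgue_measure R]_(y in `[0, x]) ((x - y) * h y)) + x.

(* For mu > 0, xe > 0 and h an intensity function, the right-hand side of the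
   equation is continuous, strictly increasing and unbounded in x >= 0 and
   vanishes at 0, so it has exactly one solution and the default value 0 is
   never used. *)
Definition social_optimum (R : realType) (mu : R) (h : R -> R) (xe : R) : R :=
  xget 0 [set x | optimality_equation mu h xe x].

(* Meaningful when arrival_rate h xe > 0, which holds for all large xe as soon
   as h has infinite integral. *)
Definition PoA (R : realType) (ct mu : R) (h : R -> R) (xe : R) : R :=
  social_benefit ct mu h xe (social_optimum mu h xe)
  / social_benefit ct mu h xe xe.

Definition rate_ratio (R : realType) (h : R -> R) (xe : R) : R :=
  arrival_rate h xe
  / \int[@lebesgue_measure R]_(y in `[0, xe]) ((1 - y / xe) * h y).

(* Main.v *)
Require Import Defs.
From HB Require Import structures.
From mathcomp Require Import all_boot all_order all_algebra.
From mathcomp Require Import all_classical all_reals all_analysis.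
From mathcomp Require Import measurable_realfun ring lra.
Set Implicit Arguments.
Unset Strict Implicit.
Unset Printing Implicit Defensive.
Import Order.TTheory GRing.Theory Num.Theory.
Import numFieldNormedType.Exports.
Local Open Scope classical_set_scope.
Local Open Scope ring_scope.

(* Write L(x) = \int_0^x h, M(x) = \int_0^x (x - y) h(y) dy and s for the
   social optimum. The optimality equation reads xe = M(s) / mu + s, which turns
   S(s) into ct * mu * (xe - s). Hence
     PoA(xe) = (xe * L(xe) / M(xe)) * (1 - s / xe) * (1 + mu / L(xe)),
   whose first factor is the rate ratio. Since L diverges, M is superlinear,
   so s / xe -> 0, and the last two factors tend to 1. *)

(** Unlike the weight [x - y] in [M], the weight [y] does not involve the upper bound, so continuity
    of an integral in its upper bound applies directly. In these terms [M x] is [x * L x - N x]. *)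
Definition first_moment {R : realType} (h : R -> R) (x : R) : R :=
  \int[@lebesgue_measure R]_(y in `[0, x]) (y * h y).

Section intensity.
Context {R : realType} {h : R -> R} (hh : intensity_function h).
Local Notation mu := (@lebesgue_measure R).
Local Notation L := (arrival_rate h).
Local Notation N := (first_moment h).

(** * Integrability, and reduction of affine weights to [L] and [N] *)

Lemma intensity_integrable (x : R) : mu.-integrable `[0, x] (EFin \o h).
Proof.
have [mh h0 hfin] := hh.
have mhx : measurable_fun `[0, x] h.
  by apply: measurable_funS mh => // y /=; rewrite !in_itv/= => /andP[->].
have [x0|x0] := leP 0 x; last first.
  by rewrite set_itv_ge ?bnd_simp -?ltNge //; exact: integrable_set0.
apply/integrableP; split; first exact/measurable_EFinP.
apply: le_lt_trans (hfin x x0); rewrite le_eqVlt; apply/orP; left; apply/eqP.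
apply: eq_integral => y; rewrite inE/= in_itv/= => /andP[y0 _].
by rewrite ger0_norm// h0.
Qed.

Lemma first_moment_integrable (x : R) :
  mu.-integrable `[0, x] (EFin \o (fun y => y * h y)).
Proof.
have mI : measurable (`[0, x] : set R) by exact: measurable_itv.
have := @integrableMr _ _ R mu `[0, x] mI id (EFin \o h).
apply => //.
- exists `|x|; split => // M xM y /=; rewrite in_itv/= => /andP[y0 yx].
  by rewrite (le_trans _ (ltW xM))// ger0_norm// (le_trans yx)// ler_norm.
- exact: intensity_integrable.
Qed.

Lemma Rintegral_affine (a b x : R) :
  \int[mu]_(y in `[0, x]) ((a - b * y) * h y) = a * L x - b * N x.
Proof.
have hi := intensity_integrable x; have Ni := first_moment_integrable x.
rewrite /arrival_rate /first_moment -!RintegralZl// -RintegralB//.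
- by apply: eq_Rintegral => y _; ring.
- exact: (integrableZl _ a hi).
- exact: (integrableZl _ b Ni).
Qed.

Lemma Rintegral_shift (a x : R) :
  \int[mu]_(y in `[0, x]) ((a - y) * h y) = a * L x - N x.
Proof.
rewrite -[N x]mul1r -Rintegral_affine.
by apply: eq_Rintegral => y _; rewrite mul1r.
Qed.

Lemma arrival_rate0 : L 0 = 0.
Proof. by rewrite /arrival_rate set_itv1 Rintegral_set1. Qed.

Lemma first_moment0 : N 0 = 0.
Proof. by rewrite /first_moment set_itv1 Rintegral_set1. Qed.

Lemma arrival_rateB (a b : R) : 0 <= a -> a <= b ->
  L b - L a = \int[mu]_(y in `]a, b]) h y.
Proof.
by move=> a0 ab; apply: Rintegral_itvB;
  rewrite ?bnd_simp//; exact: intensity_integrable.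
Qed.

Lemma first_momentB (a b : R) : 0 <= a -> a <= b ->
  N b - N a = \int[mu]_(y in `]a, b]) (y * h y).
Proof.
by move=> a0 ab; apply: Rintegral_itvB;
  rewrite ?bnd_simp//; exact: first_moment_integrable.
Qed.

(** * Monotonicity and growth bounds *)

Lemma arrival_rate_le (a b : R) : 0 <= a -> a <= b -> L a <= L b.
Proof.
move=> a0 ab; rewrite -subr_ge0 arrival_rateB//; apply: Rintegral_ge0 => y /=.
rewrite in_itv/= => /andP[ay _]; have [_ h0 _] := hh.
by apply: h0; rewrite (le_trans a0)// ltW.
Qed.

Lemma arrival_rate_ge0 (x : R) : 0 <= x -> 0 <= L x.
Proof. by move=> x0; rewrite -arrival_rate0 arrival_rate_le. Qed.

Lemma first_moment_le (a b : R) : 0 <= a -> a <= b ->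
  N b - N a <= b * (L b - L a).
Proof.
move=> a0 ab; have [_ h0 _] := hh.
have sub : `]a, b] `<=` `[0, b].
  by move=> y /=; rewrite !in_itv/= => /andP[/ltW/(le_trans a0)-> ->].
have hi : mu.-integrable `]a, b] (EFin \o h).
  by apply: integrableS (intensity_integrable b).
have Ni : mu.-integrable `]a, b] (EFin \o (fun y => y * h y)).
  by apply: integrableS (first_moment_integrable b).
rewrite first_momentB// arrival_rateB// -RintegralZl//.
apply: le_Rintegral => //; first exact: (integrableZl _ b hi).
move=> y /=; rewrite in_itv/= => /andP[ay yb].
by apply: ler_wpM2r => //; apply: h0; rewrite (le_trans a0)// ltW.
Qed.

(** For [a <= x], the part of [M x] over [[0, a]] has weight at least [x - a]; for [x < a] the left
    side is nonpositive and [M x] is nonnegative. Taking [a = 0] gives [M x >= 0]; when [L]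
    diverges, large [a] gives linear bounds of arbitrary slope. *)
Lemma delay_integral_ge (a x : R) : 0 <= a -> 0 <= x ->
  (x - a) * L a <= x * L x - N x.
Proof.
move=> a0 x0.
have N_le b : 0 <= b -> N b <= b * L b.
  move=> b0; have := first_moment_le (lexx 0) b0.
  by rewrite arrival_rate0 first_moment0 !subr0.
have [ax|xa] := leP a x.
- have := first_moment_le a0 ax; have := N_le _ a0; nra.
- have := N_le _ x0; have := arrival_rate_ge0 a0; nra.
Qed.

(** * The social optimum and the exact formula for the price of anarchy *)

Lemma optimality_equationE (m xe x : R) : optimality_equation m h xe x <->
  0 <= x /\ xe = m^-1 * (x * L x - N x) + x.
Proof. by rewrite /optimality_equation Rintegral_shift. Qed.

(** Intermediate value theorem on [[0, xe]]: [F] vanishes at 0 and, since [M] is nonnegative, [F xe]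
    is at least [xe]. *)
Lemma optimality_equation_ex (m xe : R) : 0 < m -> 0 <= xe ->
  exists x, optimality_equation m h xe x.
Proof.
move=> m0 xe0; pose F x := m^-1 * (x * L x - N x) + x.
have cL : {within `[0, xe], continuous L}.
  exact: parameterized_integral_continuous (intensity_integrable xe).
have cN : {within `[0, xe], continuous N}.
  exact: parameterized_integral_continuous (first_moment_integrable xe).
have cid : {within `[0, xe], continuous (id : R -> R)}.
  by apply: continuous_subspaceT => x; exact: cvg_id.
have cF : {within `[0, xe], continuous F}.
  move=> x; apply: cvgD; last exact: cid.
  apply: cvgM; first exact: cvg_cst.
  by apply: cvgB; [apply: cvgM; [exact: cid|exact: cL]|exact: cN].
have F0 : F 0 = 0 by rewrite /F first_moment0 mul0r subrr mulr0 addr0.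
have Fxe : xe <= F xe.
  rewrite /F lerDr mulr_ge0// ?invr_ge0 ?(ltW m0)//.
  by have := delay_integral_ge (lexx 0) xe0; rewrite arrival_rate0 mulr0.
have [|x] := @IVT R F 0 xe xe xe0 cF.
  by rewrite F0 ge_min xe0/= le_max Fxe orbT.
rewrite in_itv/= => /andP[x0 _] Fx.
by exists x; apply/optimality_equationE; split.
Qed.

Lemma social_optimumP (m xe : R) : 0 < m -> 0 <= xe ->
  optimality_equation m h xe (social_optimum m h xe).
Proof.
move=> m0 xe0.
exact: (xgetPex 0 (optimality_equation_ex m0 xe0)).
Qed.

Lemma PoA_rate_ratio (ct m xe : R) : 0 < ct -> 0 < m -> 0 < xe -> 0 < L xe ->
  PoA ct m h xe = rate_ratio h xe *
    ((1 - social_optimum m h xe / xe) * (1 + m / L xe)).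
Proof.
move=> ct0 m0 xe0 Lxe0.
have /optimality_equationE := social_optimumP m0 (ltW xe0).
rewrite /PoA /social_benefit /rate_ratio !Rintegral_shift.
move: (social_optimum m h xe) => x [x0 xeE].
rewrite (_ : Rintegral _ _ _ = L xe - xe^-1 * N xe); last first.
  rewrite -[X in X - _]mul1r -Rintegral_affine.
  by apply: eq_Rintegral => y _; rewrite [y / xe]mulrC.
have Lx0 := arrival_rate_ge0 x0.
(* The factor [m + L x] is [m] times the denominator of the benefit at [x], so it cancels there. *)
have numE : xe * L x - N x = (xe - x) * (m + L x).
  have -> : N x = x * L x - m * (xe - x) by rewrite {1}xeE; field; lra.
  by ring.
have -> : ct * (xe * L x - N x) / (1 + m^-1 * L x) = ct * m * (xe - x).
  by rewrite numE; field; apply/andP; split; lra.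
have -> : L xe - xe^-1 * N xe = xe^-1 * (xe * L xe - N xe) by field; lra.
(* If [M xe = 0], both quotients divide by zero, hence both sides are 0. *)
have [M0|M0] := eqVneq (xe * L xe - N xe) 0.
  by rewrite M0 !(mulr0, mul0r, invr0).
by field; rewrite M0 !gt_eqF// addr_gt0.
Qed.

(** * Asymptotics under infinite total intensity *)

Hypothesis hinf : (\int[mu]_(y in `[0%R, +oo[) (h y)%:E = +oo)%E.

(** Monotone convergence along integer cut-offs, whose union is the half-line; monotonicity of [L]
    later passes to real cut-offs. *)
Lemma intensity_integral_cvg_pinfty :
  (\int[mu]_(y in `[0%R, n%:R]) (h y)%:E)%E @[n --> \oo] --> +oo%E.
Proof.
have [mh h0 _] := hh.
rewrite -hinf itv_bndy_bigcup_BRight; under eq_bigcupr do rewrite add0r.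
apply: ge0_nondecreasing_set_cvg_integral => //.
- move=> n m nm; apply/subsetPset => y /=; rewrite !in_itv/=.
  by move=> /andP[-> /le_trans->]//; rewrite ler_nat.
- move=> n; apply/measurable_EFinP; apply: measurable_funS mh => // y /=.
  by rewrite !in_itv/= => /andP[->].
- by move=> n y /=; rewrite in_itv/= lee_fin => /andP[/h0].
Qed.

Lemma arrival_rate_cvg_pinfty : L x @[x --> +oo] --> +oo.
Proof.
have := intensity_integral_cvg_pinfty.
move=> /cvgeyPge hcv; apply/cvgryPge => A.
have /= [n _ /(_ n (leqnn n))/= hn] := hcv A.
have An : A <= L n%:R.
  rewrite -lee_fin; move: hn; rewrite /arrival_rate /Rintegral fineK//.
  exact: integrable_fin_num (intensity_integrable n%:R).
by near=> x; rewrite (le_trans An)// arrival_rate_le.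
Unshelve. all: by end_near. Qed.

Lemma social_optimum_ratio_cvg0 (m : R) : 0 < m ->
  social_optimum m h xe / xe @[xe --> +oo] --> 0.
Proof.
move=> m0; apply/cvgr0Pnorm_le => e e0.
(* This [K] makes the slope [K / m] equal to [2 / e]. The optimality equation then yields
   [2 / e * x <= xe + K * A / m], and the factor 2 absorbs the constant once [xe >= K * A / m]. *)
pose K := 2 * m / e; have K0 : 0 < K by rewrite divr_gt0// mulr_gt0.
have [A [A0 KA]] : exists A, 0 <= A /\ K <= L A.
  have /cvgryPge/(_ K) LK := arrival_rate_cvg_pinfty.
  have [A []] := filter_ex (filterI (nbhs_pinfty_ge (num_real (0 : R))) LK).
  by exists A.
near=> xe.
have xe0 : 0 < xe by [].
have xeA : K * A / m <= xe by [].
have /optimality_equationE[] := social_optimumP m0 (ltW xe0).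
set x := social_optimum m h xe => x0 xeE.
rewrite ger0_norm ?divr_ge0// ?(ltW xe0)// ler_pdivrMr//.
have Mge : K * (x - A) <= x * L x - N x.
  have [Ax|xA] := leP A x.
  - by rewrite (le_trans _ (delay_integral_ge A0 x0))// mulrC ler_wpM2l ?subr_ge0.
  - have := delay_integral_ge (lexx 0) x0; rewrite arrival_rate0 mulr0.
    by apply: le_trans; rewrite pmulr_rle0// subr_le0 ltW.
have : m^-1 * (K * (x - A)) + x <= xe.
  by rewrite [leRHS]xeE lerD2r ler_wpM2l// invr_ge0 ltW.
have -> : m^-1 * (K * (x - A)) = 2 / e * x - K * A / m.
  by rewrite /K; field; rewrite !gt_eqF.
move=> xle; have : 2 / e * x <= 2 * xe by lra.
by rewrite mulrAC ler_pdivrMr// -mulrA ler_pM2l// mulrC.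
Unshelve. all: by end_near. Qed.

End intensity.

(** The limit 1 is finite and nonzero, so the product of limits is defined even for infinite [l]. *)
Lemma cvg_EFinM1 {T : Type} {F : set_system T} {FF : Filter F} {R : realType}
    (f g : T -> R) (l : \bar R) :
  (f x)%:E @[x --> F] --> l -> g x @[x --> F] --> (1 : R) ->
  (f x * g x)%:E @[x --> F] --> l.
Proof.
move=> fl g1; under eq_fun do rewrite EFinM.
rewrite -[l]mule1; apply: cvgeM => //; last by apply: cvg_EFin => //; exact: nearW.
by case: l {fl} => [r| |]; rewrite /mule_def ?eqe ?oner_eq0.
Qed.

(* The limits are taken in the extended reals, so that +oo is allowed. *)
Theorem theorem3p6 (R : realType) (ct mu : R) (h : R -> R)
  (hct : 0 < ct) (hmu : 0 < mu) (hh : intensity_function h)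
  (hinf : (\int[@lebesgue_measure R]_(y in `[0%R, +oo[) (h y)%:E = +oo)%E) :
  (cvg ((PoA ct mu h xe)%:E @[xe --> +oo%R]) <->
   cvg ((rate_ratio h xe)%:E @[xe --> +oo%R])) /\
  (cvg ((PoA ct mu h xe)%:E @[xe --> +oo%R]) ->
   lim ((PoA ct mu h xe)%:E @[xe --> +oo%R]) =
   lim ((rate_ratio h xe)%:E @[xe --> +oo%R])).
Proof.
have Loo := arrival_rate_cvg_pinfty hh hinf.
have L_gt0 : \forall xe \near +oo, 0 < arrival_rate h xe.
  by move/cvgryPgt : Loo; exact.
pose g xe := (1 - social_optimum mu h xe / xe) * (1 + mu / arrival_rate h xe).
have g1 : g xe @[xe --> +oo] --> (1 : R).
  have -> : (1 : R) = (1 - 0) * (1 + mu * 0) by ring.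
  apply: cvgM; apply: cvgD; [exact: cvg_cst| |exact: cvg_cst|].
  - by apply: cvgN; exact: social_optimum_ratio_cvg0.
  - apply: cvgM; first exact: cvg_cst.
    by apply/gtr0_cvgV0.
(* The inverse factor also tends to 1, so limits transfer in both directions by the same lemma. *)
have gV1 : (g xe)^-1 @[xe --> +oo] --> (1 : R).
  by have := cvgV (oner_neq0 _) g1; rewrite invr1; apply.
have PoAE : \forall xe \near +oo, PoA ct mu h xe = rate_ratio h xe * g xe.
  by near=> xe; apply: PoA_rate_ratio => //; near: xe.
have ratioE : \forall xe \near +oo, rate_ratio h xe = PoA ct mu h xe * (g xe)^-1.
  near=> xe.
  have -> : PoA ct mu h xe = rate_ratio h xe * g xe by near: xe.
  (* Division by [g xe] is legitimate for large [xe], where its limit 1 forces it to be positive. *)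
  by rewrite mulfK// gt_eqF//; near: xe; apply: (cvgr_gt 1 g1).
have ratio_PoA (l : \bar R) : (rate_ratio h xe)%:E @[xe --> +oo] --> l ->
    (PoA ct mu h xe)%:E @[xe --> +oo] --> l.
  move=> rl; apply: cvg_trans (cvg_EFinM1 rl g1).
  by apply: near_eq_cvg; near=> xe; congr EFin; apply/esym; near: xe.
have PoA_ratio (l : \bar R) : (PoA ct mu h xe)%:E @[xe --> +oo] --> l ->
    (rate_ratio h xe)%:E @[xe --> +oo] --> l.
  move=> pl; apply: cvg_trans (cvg_EFinM1 pl gV1).
  by apply: near_eq_cvg; near=> xe; congr EFin; apply/esym; near: xe.
split; first split.
- by move=> /PoA_ratio/cvgP.
- by move=> /ratio_PoA/cvgP.
- by move=> /PoA_ratio/cvg_lim->.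
Unshelve. all: by end_near. Qed.
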